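(* Let $\Delta$ be a constant and let $G$ be an $n$-vertex connected bipartite graph with maximum degree $\Delta$. The even-odd scan dynamics $P_{EOE}$ for the ferromagnetic Ising model on $G$ (with fixed parameter $\beta>0$) has mixing time $T_{mix}(P_{EOE})=\Omega(\log n)$.
   Context: Ising model: $\mu(\sigma)=e^{-H(\sigma)}/Z$ for $\sigma\in\{-1,+1\}^V$ with $H(\sigma)=-\beta\sum_{\{u,v\}\in E}\mathbf 1(\sigma_u=\sigma_v)$, $\beta>0$. Even-odd scan: write $G=(V_E\cup V_O,E)$ with bipartition classes $V_E,V_O$, $V=V_E\cup V_O=\{v_1,\dots,v_n\}$. Let $P_i$ be the transition matrix of the heat-bath update at $v_i$ (the spin at $v_i$ is resampled from the conditional distribution of $\mu$ at $v_i$ given the configuration on $V\setminus\{v_i\}$). Then $$P_{EOE}=\prod_{i:v_i\in V_E}P_i\prod_{i:v_i\in V_O}P_i\prod_{i:v_i\in V_O}P_i\prod_{i:v_i\in V_E}P_i,$$ i.e. the symmetrized systematic scan for an ordering in which all vertices of $V_E$ precede all vertices of $V_O$ (updates within one class commute). Mixing time: $T_{mix}(P)=\min\{t>0:\max_{x}\|P^t(x,\cdot)-\mu\|_{TV}\le1/4\}$. The asymptotics are as $n\to\infty$; the constant implied by $\Omega$ may depend on $\beta$ and $\Delta$ but not on $n$ or $G$. *)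

(* Defs.v *)
From HB Require Import structures.
From mathcomp Require Import all_boot all_order all_algebra.
From mathcomp Require Import all_classical all_reals all_analysis.

Set Implicit Arguments.
Unset Strict Implicit.
Unset Printing Implicit Defensive.

Import Order.TTheory GRing.Theory Num.Theory.

Local Open Scope ring_scope.

(* A graph on V is its adjacency relation adj : rel V; a simple graph is a
   symmetric irreflexive one. *)
Section Graph.
Context {V : finType} (adj : rel V).

Definition simple_graph : Prop := symmetric adj /\ irreflexive adj.

Definition edges : {set {set V}} := [set [set u; v] | u in V, v in adj u].

Definition max_degree : nat := (\max_(v : V) #|[set u | adj v u]|)%N.

Definition connected_graph : Prop := forall u v : V, connect adj u v.

Definition bipartition (VE VO : {set V}) : Prop :=
  [/\ VE :|: VO = [set: V], [disjoint VE & VO] &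
      forall u v, adj u v ->
        (u \in VE) && (v \in VO) || (u \in VO) && (v \in VE)].

End Graph.

(* Row sigma, column tau of a transition matrix on a finite state space X are
   addressed through enum_rank.  Distributions are row vectors, so in a product
   of transition matrices the leftmost factor acts first. *)
Section MarkovChain.
Context {R : realType} {X : finType}.

Definition trans_mx (p : X -> X -> R) : 'M[R]_#|X| :=
  \matrix_(i, j) p (enum_val i) (enum_val j).

Definition trans (P : 'M[R]_#|X|) (x y : X) : R :=
  P (enum_rank x) (enum_rank y).

Definition tv_dist (p q : X -> R) : R := 2^-1 * \sum_(x : X) `|p x - q x|.

Definition max_tv (mu : X -> R) (P : 'M[R]_#|X|) (t : nat) : R :=
  \big[Num.max/0]_(x : X) tv_dist (trans (P ^+ t) x) mu.

(* The infimum of a nonempty set of natural numbers is its minimum; the value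
   is +oo if the chain never gets within distance 1/4 of mu. *)
Definition mixing_time (mu : X -> R) (P : 'M[R]_#|X|) : \bar R :=
  ereal_inf [set (t%:R)%:E | t in [set t : nat | (0 < t)%N /\ max_tv mu P t <= 4^-1]]%classic.

End MarkovChain.

Section Ising.
Context {R : realType} {V : finType} (adj : rel V) (beta : R).

(* The spin +1 is true and the spin -1 is false. *)
Definition config : finType := {ffun V -> bool}.

Definition monochromatic (sigma : config) (f : {set V}) : bool :=
  [forall u in f, forall v in f, sigma u == sigma v].

Definition hamiltonian (sigma : config) : R :=
  - beta * \sum_(f in edges adj) (monochromatic sigma f)%:R.

Definition partition_function : R :=
  \sum_(sigma : config) expR (- hamiltonian sigma).

Definition gibbs (sigma : config) : R :=
  expR (- hamiltonian sigma) / partition_function.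

Definition agree_off (v : V) (sigma tau : config) : bool :=
  [forall u, (u != v) ==> (sigma u == tau u)].

(* tau is drawn from gibbs conditioned on {rho | rho = sigma off v}. *)
Definition heat_bath (v : V) : 'M[R]_#|config| :=
  trans_mx (fun sigma tau =>
    if agree_off v sigma tau then
      gibbs tau / \sum_(rho : config | agree_off v sigma rho) gibbs rho
    else 0).

(* Each product is taken in the enumeration order of V. *)
Definition P_EOE (VE VO : {set V}) : 'M[R]_#|config| :=
  (\prod_(v in VE) heat_bath v) * (\prod_(v in VO) heat_bath v) *
  (\prod_(v in VO) heat_bath v) * (\prod_(v in VE) heat_bath v).

End Ising.

(* Main.v *)
Require Import Defs.
From HB Require Import structures.
From mathcomp Require Import all_boot all_order all_algebra.
From mathcomp Require Import all_classical all_reals all_analysis.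
From mathcomp Require Import ring lra.

(** Start the chain from all plus and from all minus. If it has mixed after [t]
    steps, both laws at time [t] are within [1/4] of the Gibbs measure, so they
    overlap in mass at least [1/2], and no observable can have means under them
    that are far apart compared with its standard deviations ([mean_gap]). The
    observable that contradicts this for small [t] is the number of plus spins on
    a set [C] of well separated sites.

    Its variance is small because information travels at finite speed. Regard the
    transition matrix as an operator on observables, a composition of [4 t] sweeps
    over independent sets, each sweep being a composition of conditional
    expectations. A sweep enlarges the support of an observable by one
    neighbourhood ([run_depends]), and as long as the supports of two observables
    stay disjoint the operator is multiplicative on their product ([runM]). If the
    balls of radius [4 t] around the sites of [C] are disjoint, the spins on [C]
    are therefore uncorrelated at time [t], and the variance is at most [#|C| / 4].
    A maximal family of such balls has [#|C| >= n / (Delta + 1)^(8 t)] members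
    ([ball_packing]).

    The two means are far apart because a disagreement cannot be forgotten quickly.
    For an increasing observable, let the influence of a site be the least amount
    by which raising its spin raises the observable. Resampling another site
    preserves this influence; resampling the site itself passes it on to any
    neighbour, up to a factor [d > 0] that depends on [beta] and [Delta] only
    ([resample_pass_on]), and this happens at most once in a sweep. So every single
    spin in [C] has means that differ by at least [d^(4 t)] between the two starts
    ([run_influence], [influence_extremes]).

    Together, [(#|C| d^(4 t))^2 <= 8 (#|C| / 4)], which gives
    [n <= 2 ((Delta + 1) / d)^(8 t)] ([mixed_card]), and a logarithm finishes the
    proof. Only the laws from two deterministic starts are compared, so that
    long-range correlations of the Gibbs measure at low temperature do no harm. *)

Set Implicit Arguments.
Unset Strict Implicit.
Unset Printing Implicit Defensive.

Import Order.TTheory GRing.Theory Num.Theory.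

Local Open Scope ring_scope.

(** * Neighbourhoods and packings *)

Section Neighborhoods.
Context {V : finType} (adj : rel V).

Definition cnbhd (A : {set V}) : {set V} :=
  [set y | [exists x in A, (x == y) || adj x y]].

Lemma cnbhdP (A : {set V}) y :
  reflect (exists2 x, x \in A & (x == y) || adj x y) (y \in cnbhd A).
Proof.
rewrite inE; apply: (iffP existsP) => [[x /andP[xA xy]]|[x xA xy]]; exists x => //.
by rewrite xA.
Qed.

Lemma subset_cnbhd (A B : {set V}) : A \subset B -> cnbhd A \subset cnbhd B.
Proof.
move=> /fintype.subsetP AB; apply/fintype.subsetP => y /cnbhdP[x /AB xB xy].
by apply/cnbhdP; exists x.
Qed.

Lemma subset_iter_cnbhd r (A B : {set V}) :
  A \subset B -> iter r cnbhd A \subset iter r cnbhd B.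
Proof. by move=> AB; elim: r => //= r; apply: subset_cnbhd. Qed.

Lemma disjoint_cnbhd (A B : {set V}) : symmetric adj ->
  [disjoint cnbhd A & B] = [disjoint A & cnbhd B].
Proof.
move=> sadj.
suff imp (C D : {set V}) : [disjoint cnbhd C & D] -> [disjoint C & cnbhd D].
  by apply/idP/idP => [/imp//|]; rewrite disjoint_sym => /imp; rewrite disjoint_sym.
move=> CD; apply/pred0P => x /=; apply/negbTE/negP => /andP[xC /cnbhdP[y yD yx]].
move/pred0P: CD => /(_ y) /negbT /negP; apply; rewrite /= yD andbT.
by apply/cnbhdP; exists x => //; rewrite eq_sym sadj.
Qed.

Lemma disjoint_iter_cnbhd r (A B : {set V}) : symmetric adj ->
  [disjoint iter r cnbhd A & B] = [disjoint A & iter r cnbhd B].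
Proof.
move=> sadj; elim: r A B => //= r IH A B.
by rewrite disjoint_cnbhd// IH -iterSr.
Qed.

Lemma card_cnbhd (A : {set V}) : (#|cnbhd A| <= #|A| * (max_degree adj).+1)%N.
Proof.
have -> : cnbhd A = \bigcup_(x in A) (x |: [set y | adj x y]).
  apply/setP => y; apply/cnbhdP/bigcupP => -[x xA]; rewrite ?inE => xy; exists x => //.
    by rewrite !inE eq_sym.
  by rewrite eq_sym.
rewrite -sum_nat_const; elim/big_rec2: _ => [|x U m _ IH]; first by rewrite cards0.
apply: leq_trans (leq_card_setU _ _) (leq_add _ IH).
apply: leq_trans (leq_card_setU _ _) _; rewrite cards1 ltnS.
exact: (leq_bigmax x).
Qed.

Lemma card_iter_cnbhd r (A : {set V}) :
  (#|iter r cnbhd A| <= #|A| * (max_degree adj).+1 ^ r)%N.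
Proof.
elim: r => [|r IH] /=; first by rewrite muln1.
by rewrite expnSr mulnA (leq_trans (card_cnbhd _))// leq_mul2r IH orbT.
Qed.

(** Take the centres of a maximal family of disjoint balls of radius [r]: by
    maximality every ball of radius [r] meets one of them, so the balls of
    radius [2 r] around the centres cover the graph. *)
Lemma ball_packing r : symmetric adj ->
  exists2 C : {set V},
    {in C &, forall u v, u != v ->
      [disjoint iter r cnbhd [set u] & iter r cnbhd [set v]]} &
    (#|V| <= #|C| * (max_degree adj).+1 ^ (r + r))%N.
Proof.
move=> sadj.
pose packed (C : {set V}) := [forall u in C, forall v in C, (u != v) ==>
  [disjoint iter r cnbhd [set u] & iter r cnbhd [set v]]].
have [|C /maxsetP[packC maxC]] := @ex_maxset _ packed.
  by exists finset.set0; apply/forallP => u; rewrite inE.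
have packedP (D : {set V}) : reflect {in D &, forall u v, u != v ->
      [disjoint iter r cnbhd [set u] & iter r cnbhd [set v]]} (packed D).
  apply: (iffP forall_inP) => [H u v uD vD|H u uD].
    by move: (H u uD) => /forall_inP/(_ v vD)/implyP.
  by apply/forall_inP => v vD; apply/implyP; apply: H.
exists C; first exact/packedP.
apply: leq_trans (card_iter_cnbhd _ _); rewrite -cardsT; apply/subset_leq_card.
apply/fintype.subsetP => x _.
suff : ~~ [disjoint [set x] & iter (r + r) cnbhd C] by rewrite disjoints1 negbK.
rewrite iterD -disjoint_iter_cnbhd//; apply/negP => dxC.
have dxc c : c \in C -> [disjoint iter r cnbhd [set x] & iter r cnbhd [set c]].
  move=> cC; apply: disjointWr dxC.
  by apply: subset_iter_cnbhd; rewrite finset.sub1set.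
have xC : x \notin C.
  apply/negP => /dxc; rewrite -setI_eq0 finset.setIid => /eqP r0.
  have : x \in iter r cnbhd [set x].
    by elim: {r0 dxc dxC packC maxC packed packedP} r => [|r IH] /=; rewrite ?set11//;
      apply/cnbhdP; exists x; rewrite ?eqxx.
  by rewrite r0 inE.
suff /maxC E : packed (x |: C).
  by move: xC; rewrite -E ?finset.subsetUr// setU11.
apply/packedP => u v; rewrite !inE.
case/predU1P => [->|uC] /predU1P[->|vC]; rewrite ?eqxx// => uv.
- exact: dxc.
- by rewrite disjoint_sym dxc.
- by move/packedP: packC; apply.
Qed.

End Neighborhoods.

(** * Transition matrices as operators on observables *)

Section Means.
Context {R : realType} {X : finType}.
Implicit Types (P Q : 'M[R]_#|X|) (h : X -> R).

Definition mean P h (x : X) : R := \sum_(y : X) trans P x y * h y.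

Lemma mean1 h : mean 1 h = h.
Proof.
apply/funext => x; rewrite /mean (bigD1 x)//= big1 ?addr0 => [|y yx].
  by rewrite /trans -[1]/(1%:M) mxE eqxx mul1r.
rewrite /trans -[1]/(1%:M) mxE.
by rewrite (inj_eq enum_rank_inj) eq_sym (negbTE yx) mul0r.
Qed.

Lemma meanM P Q h : mean (P * Q) h = mean P (mean Q h).
Proof.
apply/funext => x; rewrite /mean.
under eq_bigr => y _.
  rewrite /trans -[P * Q]/(P *m Q) mxE (reindex _ (onW_bij _ (enum_rank_bij X))).
  rewrite mulr_suml; over.
rewrite exchange_big; apply: eq_bigr => z _ /=.
by rewrite mulr_sumr; apply: eq_bigr => y _; rewrite mulrA.
Qed.

Lemma mean_sum (I : finType) (A : {set I}) P (f : I -> X -> R) x :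
  mean P (fun y => \sum_(i in A) f i y) x = \sum_(i in A) mean P (f i) x.
Proof.
by rewrite /mean; under eq_bigr do rewrite mulr_sumr; exact: exchange_big.
Qed.

Lemma trans_mean P x y : trans P x y = mean P (fun z => (z == y)%:R) x.
Proof.
rewrite /mean (bigD1 y)//= eqxx mulr1 big1 ?addr0// => z /negbTE ->.
by rewrite mulr0.
Qed.

(** Two distributions within [1/4] of a third overlap in mass at least [1/2]:
    integrating [(a - b)^2 <= 2 (f - a)^2 + 2 (f - b)^2] against their minimum
    bounds the gap between the two means of [f] by the two variances. *)
Lemma mean_gap P (mu f : X -> R) x y (v : R) :
  (forall z w, 0 <= trans P z w) -> mean P (fun=> 1) = (fun=> 1) ->
  tv_dist (trans P x) mu <= 4^-1 -> tv_dist (trans P y) mu <= 4^-1 ->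
  mean P (fun z => f z ^+ 2) x - mean P f x ^+ 2 <= v ->
  mean P (fun z => f z ^+ 2) y - mean P f y ^+ 2 <= v ->
  (mean P f x - mean P f y) ^+ 2 <= 8 * v.
Proof.
move=> P0 P1 tvx tvy vx vy.
set a := mean P f x in vx *; set b := mean P f y in vy *.
pose p := trans P x; pose q := trans P y.
have var z c : \sum_w trans P z w * (f w - c) ^+ 2 =
    mean P (fun w => f w ^+ 2) z - 2 * c * mean P f z + c ^+ 2.
  have -> : c ^+ 2 = c ^+ 2 * mean P (fun=> 1) z by rewrite P1 mulr1.
  rewrite /mean !mulr_sumr -sumrB -big_split; apply: eq_bigr => w _ /=; ring.
have sum1 z : \sum_w trans P z w = 1.
  transitivity (mean P (fun=> 1) z); last by rewrite P1.
  by apply: eq_bigr => w _; rewrite mulr1.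
have tv : \sum_w `|p w - q w| <= 1.
  have : \sum_w `|p w - q w| <= \sum_w `|p w - mu w| + \sum_w `|q w - mu w|.
    rewrite -big_split; apply: ler_sum => w _ /=.
    by rewrite (distrC (q w)) (le_trans _ (ler_normD _ _))// addrA subrK.
  move: tvx tvy; rewrite /tv_dist -/p -/q; lra.
have : \sum_w (p w + q w - `|p w - q w|) * (a - b) ^+ 2 <=
       \sum_w 4 * (p w * (f w - a) ^+ 2 + q w * (f w - b) ^+ 2).
  apply: ler_sum => w _.
  (* [p + q - |p - q|] is twice the minimum of [p] and [q]. *)
  have sq : (a - b) ^+ 2 <= 2 * (f w - a) ^+ 2 + 2 * (f w - b) ^+ 2.
    by rewrite -subr_ge0 (_ : _ - _ = (2 * f w - a - b) ^+ 2) ?sqr_ge0//; ring.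
  have A0 := sqr_ge0 (f w - a); have B0 := sqr_ge0 (f w - b).
  have p0 : 0 <= p w by exact: P0.
  have q0 : 0 <= q w by exact: P0.
  have m0 : 0 <= p w + q w - `|p w - q w|.
    by rewrite subr_ge0 ler_norml; apply/andP; split; lra.
  have mp : p w + q w - `|p w - q w| <= 2 * p w.
    by have := ler_norm (q w - p w); rewrite distrC; lra.
  have mq : p w + q w - `|p w - q w| <= 2 * q w.
    by have := ler_norm (p w - q w); lra.
  apply: le_trans (ler_wpM2l m0 sq) _.
  have := ler_wpM2r A0 mp; have := ler_wpM2r B0 mq; lra.
rewrite -mulr_suml sumrB big_split /= !sum1 -mulr_sumr big_split /= !var -/a -/b.
have := sqr_ge0 (a - b).
set s := \sum_w `|_| in tv *; set D := (a - b) ^+ 2 => D0 le.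
have := ler_wpM2r D0 tv; lra.
Qed.

End Means.

(** * Heat-bath updates *)

Section HeatBath.
Context {R : realType} {V : finType} (adj : rel V) (beta : R).
Context (sadj : simple_graph adj).
Local Notation conf := (@config V).

Definition upd (s : conf) v b : conf := [ffun u => if u == v then b else s u].

Definition local_field (s : conf) v : R :=
  \sum_(u | adj v u) (if s u then 1 else -1).

Definition logistic (x : R) : R := (1 + expR (- x))^-1.

(** The conditional expectation of [h] given the spins off [v]; the probability of
    a plus spin is written through the neighbours of [v] only, which makes its
    locality and monotonicity visible. *)
Definition resample v (h : conf -> R) (s : conf) : R :=
  let p := logistic (beta * local_field s v) in
  p * h (upd s v true) + (1 - p) * h (upd s v false).

Definition energy (s : conf) : R :=
  \sum_(f in edges adj) (monochromatic s f)%:R.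

Lemma incident_edges v :
  [set f in edges adj | v \in f] = [set [set v; u] | u in [set u | adj v u]].
Proof.
apply/setP => f; rewrite !inE; apply/andP/imsetP => [[/imset2P[x y _]]|[u]].
  move=> xy ->; rewrite !inE => /orP[]/eqP ->.
    by exists y; rewrite ?inE.
  by exists x; rewrite ?inE 1?finset.setUC// sadj.1.
rewrite inE => vu ->; split; last by rewrite !inE eqxx.
by apply/imset2P; exists v u.
Qed.

(** Splitting off the edges at [v] isolates the part of the energy that depends
    on the spin of [v]. *)
Lemma energy_upd s v b : energy (upd s v b) =
  \sum_(f in edges adj | v \notin f) (monochromatic s f)%:R +
  \sum_(u | adj v u) (s u == b)%:R.
Proof.
rewrite /energy (bigID (fun f : {set V} => v \in f)) /= addrC; congr (_ + _).
  apply: eq_bigr => f /andP[_ vf]; congr (_%:R); congr nat_of_bool.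
  rewrite /monochromatic; apply: eq_forallb_in => x xf; apply: eq_forallb_in => y yf.
  have off z : z \in f -> (z == v) = false.
    by move=> zf; apply: contraNF vf => /eqP <-.
  by rewrite !ffunE !off.
transitivity (\sum_(f in [set f in edges adj | v \in f]) (monochromatic (upd s v b) f)%:R : R).
  by apply: eq_bigl => f; rewrite inE.
rewrite incident_edges big_imset /=; last first.
  move=> x y; rewrite !inE => vx vy /setP/(_ x); rewrite !inE eqxx orbT.
  have /negbTE -> : x != v by apply: contraTneq vx => ->; rewrite sadj.2.
  by move=> /esym/eqP.
apply: eq_big => [u|u]; rewrite inE// => vu; congr (_%:R); congr nat_of_bool.
have uv : (u == v) = false by case: eqP vu => // ->; rewrite sadj.2.
apply/forall_inP/eqP => [|sub x].
  move=> /(_ v); rewrite !inE eqxx => /(_ isT)/forall_inP/(_ u).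
  by rewrite !inE !ffunE !eqxx uv orbT => /(_ isT)/eqP.
rewrite !inE => xE; apply/forall_inP => y; rewrite !inE !ffunE => yE.
by case/orP: xE => /eqP->; case/orP: yE => /eqP->; rewrite ?eqxx ?uv ?sub.
Qed.

Lemma energy_field s v :
  energy (upd s v true) - energy (upd s v false) = local_field s v.
Proof.
rewrite !energy_upd opprD addrACA subrr add0r -sumrB; apply: eq_bigr => u _.
by case: (s u) => /=; rewrite ?subr0 ?sub0r.
Qed.

Lemma sum_agree_off v s (F : conf -> R) :
  \sum_(t | agree_off v s t) F t = F (upd s v true) + F (upd s v false).
Proof.
have agP t : agree_off v s t = (t == upd s v true) || (t == upd s v false).
  apply/forallP/orP => [H|H u].
    have {}H b : t v = b -> t = upd s v b.
      move=> tv; apply/ffunP => u; rewrite ffunE; case: eqP => [->//|/eqP uv].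
      by move: (H u); rewrite uv => /eqP.
    by case E: (t v) (H _ erefl) => ->; rewrite eqxx; [left|right].
  by apply/implyP => uv; case: H => /eqP ->; rewrite ffunE (negbTE uv).
have ne : upd s v false != upd s v true.
  by apply/eqP => /ffunP/(_ v); rewrite !ffunE eqxx.
rewrite (bigD1 (upd s v true)) ?agP ?eqxx//=; congr (_ + _).
rewrite (bigD1 (upd s v false)) ?agP ?eqxx ?ne ?orbT//= big1 ?addr0// => t.
by rewrite agP; case: eqP => //=; case: eqP.
Qed.

Lemma gibbsE s : gibbs adj beta s = expR (beta * energy s) / partition_function adj beta.
Proof. by rewrite /gibbs /hamiltonian -/(energy s) mulNr opprK. Qed.

Lemma partition_function_gt0 : 0 < partition_function adj beta.
Proof.
rewrite /partition_function (bigD1 [ffun=> true])//= ltr_wpDr ?expR_gt0//.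
by apply: sumr_ge0 => s _; apply/ltW/expR_gt0.
Qed.

(** The partition function and the edges away from [v] cancel in the conditional
    probabilities, which leaves a logistic function of the neighbouring spins. *)
Lemma mean_heat_bath v h : mean (heat_bath adj beta v) h = resample v h.
Proof.
apply/funext => s; rewrite /mean.
under eq_bigr => t _.
  rewrite /trans mxE !enum_rankK (fun_if (fun x => x * h t)) mul0r; over.
rewrite -big_mkcond sum_agree_off sum_agree_off !gibbsE /resample.
have Z0 := lt0r_neq0 partition_function_gt0.
set z := partition_function _ _ in Z0 *.
have e x : 0 < expR x :> R by exact: expR_gt0.
have -> : logistic (beta * local_field s v) = expR (beta * energy (upd s v true)) /
    (expR (beta * energy (upd s v true)) + expR (beta * energy (upd s v false))).
  rewrite /logistic -energy_field -mulrN opprB mulrBr expRB.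
  have := lt0r_neq0 (e (beta * energy (upd s v true))).
  have := e (beta * energy (upd s v true)); have := e (beta * energy (upd s v false)).
  set x := expR _; set y := expR _ => x0 y0 y1.
  by field; rewrite y1 lt0r_neq0// addr_gt0.
have := e (beta * energy (upd s v true)); have := e (beta * energy (upd s v false)).
set x := expR _; set y := expR _ => x0 y0.
have xy : y + x != 0 by rewrite lt0r_neq0// addr_gt0.
by field; rewrite Z0 xy.
Qed.

Lemma mean_class (A : {set V}) h :
  mean (\prod_(v in A) heat_bath adj beta v) h =
  foldr resample h [seq v <- index_enum V | v \in A].
Proof.
rewrite -big_filter; elim: [seq _ <- _ | _] => [|v l IH] /=; first by rewrite big_nil mean1.
by rewrite big_cons meanM IH mean_heat_bath.
Qed.

End HeatBath.

(** * Finite speed of propagation *)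

Section Locality.
Context {R : realType} {V : finType} (adj : rel V) (beta : R).
Local Notation conf := (@config V).
Local Notation resamp := (resample adj beta).
Local Notation cnbhd := (cnbhd adj).
Implicit Types (S A : {set V}) (f g h : conf -> R) (l : seq V).

Definition depends_on S h : Prop :=
  forall s t : conf, {in S, forall u, s u = t u} -> h s = h t.

Lemma depends_onS S A h : S \subset A -> depends_on S h -> depends_on A h.
Proof. by move=> /fintype.subsetP SA hS s t st; apply: hS => u /SA/st. Qed.

Lemma depends_on_upd S h v s b : depends_on S h -> v \notin S -> h (upd s v b) = h s.
Proof.
move=> hS vS; apply: hS => u uS; rewrite ffunE.
by have /negbTE -> : u != v by apply: contraNneq vS => <-.
Qed.

Lemma resample_id S h v : depends_on S h -> v \notin S -> resamp v h = h.
Proof.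
move=> hS vS; apply/funext => s; rewrite /resample !(depends_on_upd _ _ hS vS).
by ring.
Qed.

Lemma resample_depends S h v : depends_on S h ->
  (v \in S -> forall u, adj v u -> u \in S) -> depends_on S (resamp v h).
Proof.
move=> hS; case: (boolP (v \in S)) => [vS /(_ isT) NS|vS _]; last first.
  by rewrite (resample_id hS vS).
move=> s t st; have fE : local_field adj s v = local_field adj t v :> R.
  by apply: eq_bigr => u /NS/st ->.
have hE b : h (upd s v b) = h (upd t v b).
  by apply: hS => u /st; rewrite !ffunE => ->.
by rewrite /resample fE !hE.
Qed.

(** One of the two factors does not see the spin at [v] and can be taken out of
    the conditional expectation. *)
Lemma resampleM S A f g v : depends_on S f -> depends_on A g -> [disjoint S & A] ->
  resamp v (fun s => f s * g s) = fun s => resamp v f s * resamp v g s.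
Proof.
move=> fS gA SA.
have out B (k k' : conf -> R) : depends_on B k -> v \notin B ->
    resamp v (fun s => k s * k' s) = fun s => resamp v k s * resamp v k' s.
  move=> kB vB; rewrite (resample_id kB vB); apply/funext => s.
  by rewrite /resample !(depends_on_upd _ _ kB vB); ring.
case: (boolP (v \in S)) => [vS|]; last exact: out fS.
have vA : v \notin A by rewrite (disjointFr SA vS).
have -> : (fun s => f s * g s) = (fun s => g s * f s) by apply/funext => s; rewrite mulrC.
by rewrite (out _ _ _ gA vA); apply/funext => s; rewrite mulrC.
Qed.

Definition sweep l h := foldr resamp h l.

Definition independent l : Prop := {in l &, forall u v, ~~ adj u v}.

(** A support with this property is not enlarged by the updates in [l]. *)
Definition nbr_closed l A : Prop :=
  {in l, forall v, v \in A -> forall u, adj v u -> u \in A}.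

Lemma sweep_depends l A h : nbr_closed l A -> depends_on A h -> depends_on A (sweep l h).
Proof.
elim: l => //= v l IH cA hA; apply: resample_depends; last exact/cA/mem_head.
by apply: IH => // u ul; apply: cA; rewrite inE ul orbT.
Qed.

Lemma sweepM l S A f g : nbr_closed l S -> nbr_closed l A ->
  depends_on S f -> depends_on A g -> [disjoint S & A] ->
  sweep l (fun s => f s * g s) = fun s => sweep l f s * sweep l g s.
Proof.
move=> + + fS gA SA; elim: l => //= v l IH cS cA.
have clS : nbr_closed l S by move=> u ul; apply: cS; rewrite inE ul orbT.
have clA : nbr_closed l A by move=> u ul; apply: cA; rewrite inE ul orbT.
by rewrite IH// (resampleM (S := S) (A := A))//; apply: sweep_depends.
Qed.

(** The updated sites of [S] contribute their neighbours, and these lie outside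
    the independent set being updated, so the support grows only once during a
    whole sweep. *)
Lemma nbr_closed_hull l S : independent l ->
  exists2 A : {set V}, S \subset A /\ A \subset cnbhd S & nbr_closed l A.
Proof.
move=> indl; exists (S :|: cnbhd [set v in S | v \in l]).
  split; first exact: finset.subsetUl.
  rewrite finset.subUset; apply/andP; split.
    by apply/fintype.subsetP => u uS; apply/cnbhdP; exists u; rewrite ?eqxx.
  apply: subset_cnbhd; apply/fintype.subsetP => u; by rewrite inE => /andP[].
move=> v vl + u vu; rewrite !finset.in_setU => /orP[vS|/cnbhdP[x]].
  by apply/orP; right; apply/cnbhdP; exists v; rewrite ?inE ?vS ?vl ?vu ?orbT.
rewrite inE => /andP[xS xl] /orP[/eqP xv|xv]; last by have := indl x v xl vl; rewrite xv.
by apply/orP; right; apply/cnbhdP; exists v; rewrite ?vu ?orbT// inE -xv xS xl.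
Qed.

Definition run (ls : seq (seq V)) h := foldr sweep h ls.

Lemma run_depends ls S h : {in ls, forall l, independent l} ->
  depends_on S h -> depends_on (iter (size ls) cnbhd S) (run ls h).
Proof.
move=> + hS; elim: ls => //= l ls IH ind.
have {}IH : depends_on (iter (size ls) cnbhd S) (run ls h).
  by apply: IH => l' l'ls; apply: ind; rewrite inE l'ls orbT.
have [A [SA AN] cA] := nbr_closed_hull (iter (size ls) cnbhd S) (ind l (mem_head _ _)).
by apply: depends_onS AN _; apply: sweep_depends => //; apply: depends_onS IH.
Qed.

(** Two observables with disjoint light cones are uncorrelated at any later time,
    from any deterministic start. *)
Lemma runM ls S A f g : {in ls, forall l, independent l} ->
  depends_on S f -> depends_on A g ->
  [disjoint iter (size ls) cnbhd S & iter (size ls) cnbhd A] ->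
  run ls (fun s => f s * g s) = fun s => run ls f s * run ls g s.
Proof.
move=> + fS gA; elim: ls => //= l ls IH ind.
have indls : {in ls, forall l, independent l}.
  by move=> l' l'ls; apply: ind; rewrite inE l'ls orbT.
have indl := ind l (mem_head _ _).
have [S' [SS' S'N] cS'] := nbr_closed_hull (iter (size ls) cnbhd S) indl.
have [A' [AA' A'N] cA'] := nbr_closed_hull (iter (size ls) cnbhd A) indl.
move=> dis; have dis' := disjointW S'N A'N dis.
rewrite IH//; last exact: disjointW dis'.
apply: (sweepM (S := S') (A := A')) => //.
  by apply: depends_onS SS' _; apply: run_depends.
by apply: depends_onS AA' _; apply: run_depends.
Qed.

End Locality.

(** * Persistence of a disagreement *)

Section Influence.
Context {R : realType} {V : finType} (adj : rel V) (beta : R).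
Context (beta_gt0 : 0 < beta) (sadj : simple_graph adj).
Local Notation conf := (@config V).
Local Notation resamp := (resample adj beta).
Implicit Types (h : conf -> R) (l : seq V) (s t : conf).

Lemma logistic01 (x : R) : 0 < logistic x < 1.
Proof.
have e := expR_gt0 (- x).
by rewrite /logistic invr_gt0 invf_lt1 ?ltrDl ?e ?andbT addr_gt0.
Qed.

Lemma logistic_le (x y : R) : x <= y -> logistic x <= logistic y.
Proof.
move=> xy; rewrite /logistic lef_pV2 ?posrE ?addr_gt0 ?expR_gt0//.
by rewrite lerD2l ler_expR lerN2.
Qed.

(** A lower bound on the change of the conditional probability of a plus spin
    when one neighbour is flipped, at a site of degree at most [D]. *)
Definition flip_gap (D : nat) : R :=
  (1 - expR (- (2 * beta))) / (expR (beta * D%:R) * (1 + expR (beta * D%:R)) ^+ 2).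

Lemma flip_gap_gt0 D : 0 < flip_gap D.
Proof.
have e := expR_gt0 (beta * D%:R).
apply: divr_gt0; last by rewrite mulr_gt0 ?exprn_gt0 ?addr_gt0.
by rewrite subr_gt0 expR_lt1 oppr_lt0 mulr_gt0.
Qed.

Lemma flip_gap_le1 D : flip_gap D <= 1.
Proof.
have e := expR_gt0 (beta * D%:R).
have e1 : 1 <= expR (beta * D%:R) by rewrite -expR0 ler_expR mulr_ge0// ltW.
rewrite ler_pdivrMr ?mulr_gt0 ?exprn_gt0 ?addr_gt0// mul1r.
apply: (@le_trans _ _ 1); first by rewrite gerBl ltW ?expR_gt0.
by rewrite mulr_ege1// exprn_ege1// lerDl.
Qed.

Lemma logistic_gap D (x : R) : - (beta * D%:R) <= x -> x + 2 * beta <= beta * D%:R ->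
  logistic x + flip_gap D <= logistic (x + 2 * beta).
Proof.
move=> lx ux; rewrite /logistic /flip_gap opprD expRD.
set M := expR (beta * _); set r := expR (- (2 * _)); set y := expR (- x).
have r0 : 0 < r by exact: expR_gt0.
have r1 : r < 1 by rewrite expR_lt1 oppr_lt0 mulr_gt0.
have y0 : 0 < y by exact: expR_gt0.
have M0 : 0 < M by exact: expR_gt0.
have yM : y <= M by rewrite ler_expR lerNl.
have My : M^-1 <= y by rewrite /M -expRN ler_expR lerN2; have := beta_gt0; lra.
have yr0 : 0 < y * r by exact: mulr_gt0.
have yrM : y * r <= M by rewrite (le_trans _ yM)// ler_piMr// ltW.
rewrite -lerBrDl.
(* With [y = exp (- x)] and [r = exp (- 2 beta)] the two values are
   [(1 + y)^-1] and [(1 + y r)^-1]. *)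
have -> : (1 + y * r)^-1 - (1 + y)^-1 = (1 - r) * (y / ((1 + y * r) * (1 + y))).
  by field; rewrite !lt0r_neq0// addr_gt0.
rewrite ler_wpM2l ?subr_ge0 ?(ltW r1)// invfM.
apply: ler_pM => //; rewrite ?invr_ge0 ?exprn_ge0 ?addr_ge0 ?(ltW M0)//.
rewrite lef_pV2 ?posrE ?exprn_gt0 ?mulr_gt0 ?addr_gt0//.
by rewrite expr2 ler_pM ?addr_ge0 ?lerD2l// ltW.
Qed.

Lemma local_field_flip s v w : local_field adj (upd s w true) v =
  local_field adj (upd s w false) v + (if adj v w then 2 else 0) :> R.
Proof.
rewrite /local_field; case: ifP => vw; last first.
  rewrite addr0; apply: eq_bigr => u vu; rewrite !ffunE; case: eqP => // uw.
  by rewrite -uw vu in vw.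
rewrite (bigD1 w)//= [in RHS](bigD1 w)//= !ffunE !eqxx.
rewrite [in RHS](eq_bigr (fun u => if upd s w true u then 1 else -1 : R)); last first.
  by move=> u /andP[_ /negbTE uw]; rewrite !ffunE uw.
by ring.
Qed.

Lemma local_field_bound s v : `|local_field adj s v : R| <= (max_degree adj)%:R.
Proof.
apply: le_trans (ler_norm_sum _ _ _) _.
rewrite (eq_bigr (fun=> 1)); last by move=> u _; case: (s u); rewrite ?normrN normr1.
rewrite sumr_const ler_nat (leq_trans _ (leq_bigmax v))//.
by rewrite cardsE.
Qed.

Definition influence h w (e : R) : Prop :=
  forall s, h (upd s w false) + e <= h (upd s w true).

Definition increasing h : Prop := forall w, influence h w 0.

Lemma updC s v w a b : v != w -> upd (upd s v a) w b = upd (upd s w b) v a.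
Proof.
move=> vw; apply/ffunP => u; rewrite !ffunE; case: eqP => // ->.
by rewrite eq_sym (negbTE vw).
Qed.

Lemma upd_upd s v a b : upd (upd s v a) v b = upd s v b.
Proof. by apply/ffunP => u; rewrite !ffunE; case: eqP. Qed.

Lemma local_field_le s v w : local_field adj (upd s w false) v <=
  local_field adj (upd s w true) v :> R.
Proof. by rewrite local_field_flip lerDl; case: ifP. Qed.

(** The plus probability at [v] does not decrease when [w] is raised, and by the
    monotonicity of [h] in [v] this can only add to the difference. *)
Lemma resample_influence h v w e : w != v -> influence h w e -> influence h v 0 ->
  influence (resamp v h) w e.
Proof.
move=> wv hw hv s; rewrite /resample !(updC _ _ _ wv).
have pq := logistic_le (ler_wpM2l (ltW beta_gt0) (local_field_le s v w)).
have /andP[p0 p1] := logistic01 (beta * local_field adj (upd s w false) v).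
have A := hw (upd s v true); have B := hw (upd s v false).
have := hv (upd s w true); rewrite !(updC _ _ _ wv) => C.
set p := logistic _ in pq p0 p1 *; set q := logistic _ in pq *.
set a := h _ in A *; set a' := h _ in A C *; set b := h _ in B *; set b' := h _ in B C *.
have C' : 0 <= (q - p) * (a' - b') by rewrite mulr_ge0//; lra.
have A' : 0 <= p * (a' - a - e) by rewrite mulr_ge0//; lra.
have B' : 0 <= (1 - p) * (b' - b - e) by rewrite mulr_ge0//; lra.
lra.
Qed.

Lemma resample_increasing h v : increasing h -> increasing (resamp v h).
Proof.
move=> hi w; have [->|wv] := eqVneq w v; last exact: resample_influence.
by move=> s; rewrite addr0 /resample !upd_upd local_field_flip sadj.2 addr0.
Qed.

(** Resampling [v] forgets its spin, but the new spin leans towards that of the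
    neighbour [w]: the influence of [v] is passed on to [w]. *)
Lemma resample_pass_on D h v w e : (max_degree adj <= D)%N -> adj v w -> 0 <= e ->
  increasing h -> influence h v e -> influence (resamp v h) w (flip_gap D * e).
Proof.
move=> degD vw e0 hi hv s.
have wv : w != v by apply: contraTneq vw => ->; rewrite sadj.2.
have bnd t : - (beta * D%:R) <= beta * local_field adj t v <= beta * D%:R.
  rewrite -ler_norml normrM (gtr0_norm beta_gt0) ler_wpM2l ?(ltW beta_gt0)//.
  by rewrite (le_trans (local_field_bound t v))// ler_nat.
have fE : beta * local_field adj (upd s w true) v =
    beta * local_field adj (upd s w false) v + 2 * beta.
  by rewrite local_field_flip vw mulrDr [beta * 2]mulrC.
have gap : logistic (beta * local_field adj (upd s w false) v) + flip_gap D <=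
    logistic (beta * local_field adj (upd s w true) v).
  rewrite fE; apply: logistic_gap; first by case/andP: (bnd (upd s w false)).
  by rewrite -fE; case/andP: (bnd (upd s w true)).
rewrite /resample !(updC _ _ _ wv).
have /andP[p0 p1] := logistic01 (beta * local_field adj (upd s w false) v).
have := hv (upd s w true); rewrite !(updC _ _ _ wv) => C.
have A := hi w (upd s v true); have B := hi w (upd s v false).
have d0 := flip_gap_gt0 D.
set p := logistic _ in gap p0 p1 *; set q := logistic _ in gap *.
set d := flip_gap D in gap d0 *.
set a := h _ in A *; set a' := h _ in A C *; set b := h _ in B *; set b' := h _ in B C *.
(* The increase of the average, less [d * e], is the sum of the four products. *)
have G : 0 <= (q - p - d) * (a' - b') by rewrite mulr_ge0//; lra.
have C' : 0 <= d * (a' - b' - e) by rewrite mulr_ge0//; lra.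
have A' : 0 <= p * (a' - a) by rewrite mulr_ge0//; lra.
have B' : 0 <= (1 - p) * (b' - b) by rewrite mulr_ge0//; lra.
lra.
Qed.

Lemma influenceW h w e e' : e' <= e -> influence h w e -> influence h w e'.
Proof. by move=> ee hw s; apply: le_trans (hw s); rewrite lerD2l. Qed.

Lemma sweep_increasing h l : increasing h -> increasing (sweep adj beta l h).
Proof. by move=> hi; elim: l => //= v l IH; apply: resample_increasing. Qed.

(** If the influential site [w] is resampled, its influence moves to a neighbour
    [x]; that neighbour is not updated in the same sweep, so nothing more is
    lost until the next one. *)
Lemma sweep_influence D h l w e : (max_degree adj <= D)%N ->
  (forall v, exists x, adj v x) -> independent adj l -> 0 <= e ->
  increasing h -> influence h w e ->
  exists x, influence (sweep adj beta l h) x (flip_gap D * e).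
Proof.
move=> degD nbr indl e0 hi hw.
have de : flip_gap D * e <= e by rewrite ler_piMl// flip_gap_le1.
have stay l' : w \notin l' -> influence (sweep adj beta l' h) w e.
  elim: l' => //= v l' IH; rewrite inE negb_or => /andP[wv wl'].
  by apply: resample_influence; [|exact: IH|exact: sweep_increasing].
have [wl|wl] := boolP (w \in l); last first.
  by exists w; apply: influenceW de _; apply: stay.
have [x wx] := nbr w; exists x.
have xl : x \notin l by apply: contraL wx => /(indl w x wl).
elim: l {indl} wl xl => //= v l IH; rewrite !inE negb_or => wvl /andP[xv xl].
have [wl|wl] := boolP (w \in l).
  by apply: resample_influence; [|exact: IH|exact: sweep_increasing].
move: wvl; rewrite (negbTE wl) orbF => /eqP <-.
by apply: resample_pass_on => //; [exact: sweep_increasing|exact: stay].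
Qed.

Lemma run_increasing h ls : increasing h -> increasing (run adj beta ls h).
Proof. by move=> hi; elim: ls => //= l ls IH; apply: sweep_increasing. Qed.

Lemma run_influence D h ls w e : (max_degree adj <= D)%N ->
  (forall v, exists x, adj v x) -> {in ls, forall l, independent adj l} ->
  0 <= e -> increasing h -> influence h w e ->
  exists x, influence (run adj beta ls h) x (flip_gap D ^+ size ls * e).
Proof.
move=> degD nbr + e0 hi hw; elim: ls => [|l ls IH] ind /=.
  by exists w; rewrite mul1r.
have [|x hx] := IH; first by move=> l' l'ls; apply: ind; rewrite inE l'ls orbT.
have [||y hy] := sweep_influence degD nbr (ind l (mem_head _ _)) _ _ hx.
- by rewrite mulr_ge0// exprn_ge0// ltW// flip_gap_gt0.
- exact: run_increasing.
by exists y; rewrite exprS -mulrA.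
Qed.

Lemma upd_same s x : upd s x (s x) = s.
Proof. by apply/ffunP => u; rewrite ffunE; case: eqP => [->|]. Qed.

Lemma increasing_upd h s x : increasing h -> h s <= h (upd s x true).
Proof.
move=> hi; rewrite -[in leLHS](upd_same s x); case: (s x) => //.
by have := hi x s; rewrite addr0.
Qed.

Lemma increasing_max h s : increasing h -> h s <= h [ffun=> true].
Proof.
move=> hi.
have -> : [ffun=> true] = foldr (fun x t => upd t x true) s (enum V).
  apply/ffunP => u; rewrite ffunE.
  elim: (enum V) (mem_enum V u) => //= x l IH; rewrite inE ffunE.
  by case: eqP => //= _; apply: IH.
elim: (enum V) => //= x l IH; exact: le_trans IH (increasing_upd _ _ hi).
Qed.

Lemma influence_extremes h w e : increasing h -> influence h w e ->
  h [ffun=> false] + e <= h [ffun=> true].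
Proof.
move=> hi hw; apply: le_trans (increasing_max (upd [ffun=> false] w true) hi).
rewrite -[in leLHS](upd_same [ffun=> false] w) ffunE; exact: hw.
Qed.

End Influence.

(** * Lower bound on the mixing time *)

Section EvenOdd.
Context {R : realType} {V : finType} (adj : rel V) (beta : R) (VE VO : {set V}).
Context (sadj : simple_graph adj) (bip : bipartition adj VE VO).
Local Notation conf := (@config V).
Local Notation P := (P_EOE adj beta VE VO).
Implicit Types (h : conf -> R) (s : conf).

Definition class_seq (A : {set V}) : seq V := [seq v <- index_enum V | v \in A].

Definition rounds t : seq (seq V) :=
  flatten (nseq t [:: class_seq VE; class_seq VO; class_seq VO; class_seq VE]).

Lemma size_rounds t : size (rounds t) = (4 * t)%N.
Proof. by elim: t => //= t IH; rewrite mulnS -IH. Qed.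

Lemma independent_rounds t : {in rounds t, forall l, independent adj l}.
Proof.
have [_ dis cross] := bip.
have indE : independent adj (class_seq VE).
  move=> u v; rewrite !mem_filter => /andP[uE _] /andP[vE _]; apply/negP => /cross.
  by rewrite (disjointFr dis uE) (disjointFr dis vE) !andbF.
have indO : independent adj (class_seq VO).
  move=> u v; rewrite !mem_filter => /andP[uO _] /andP[vO _]; apply/negP => /cross.
  by rewrite (disjointFl dis uO) (disjointFl dis vO) !andbF.
elim: t => //= t IH l; rewrite !inE.
by case/or4P => [/eqP->|/eqP->|/eqP->|/predU1P[->|/IH]].
Qed.

Lemma mean_rounds t h : mean (P ^+ t) h = run adj beta (rounds t) h.
Proof.
elim: t h => [|t IH] h; first by rewrite expr0 mean1.
by rewrite exprS meanM IH /P_EOE !meanM !mean_class.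
Qed.

Lemma run1 ls : run adj beta ls (fun=> 1) = fun=> 1.
Proof.
elim: ls => //= l ls ->; elim: l => //= v l ->.
by apply: (@resample_id _ _ _ _ finset.set0); rewrite ?inE.
Qed.

Lemma run_ge0 ls h : (forall s, 0 <= h s) -> forall s, 0 <= run adj beta ls h s.
Proof.
move=> h0; elim: ls => //= l ls IH; elim: l => //= v l {}IH s.
have /andP[/ltW p0 /ltW p1] := logistic01 (beta * local_field adj s v).
by rewrite addr_ge0// mulr_ge0// subr_ge0.
Qed.

Lemma plus_depends v : depends_on [set v] (fun s : conf => (s v)%:R : R).
Proof. by move=> s t ->//; rewrite inE. Qed.

(** The test function is the number of plus spins on the centres of a packing by
    balls whose radius is the range of dependence after [t] steps. The spins at
    the centres are uncorrelated, hence a variance of at most [#|C| / 4], while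
    the two constant starting configurations give expectations that differ by
    [#|C| flip_gap^(4 t)] at least. *)
Lemma mixed_card t (mu : conf -> R) : 0 < beta ->
  (forall v, exists x, adj v x) -> max_tv mu P t <= 4^-1 ->
  #|V|%:R * flip_gap beta (max_degree adj) ^+ (8 * t) <=
    2 * (max_degree adj).+1%:R ^+ (8 * t).
Proof.
move=> beta_gt0 nbr mixed.
set D := max_degree adj; set d := flip_gap beta D; pose ls := rounds t.
have d0 : 0 < d by exact: flip_gap_gt0.
have ind := @independent_rounds t.
have [C disC cardC] := @ball_packing _ adj (4 * t) sadj.1.
pose g u : conf -> R := fun s => (s u)%:R.
pose f s := \sum_(u in C) g u s.
have gap : #|C|%:R * d ^+ (4 * t) <=
    mean (P ^+ t) f [ffun=> true] - mean (P ^+ t) f [ffun=> false].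
  rewrite !mean_sum -sumrB mulr_natl -sumr_const; apply: ler_sum => u _.
  rewrite mean_rounds lerBrDl.
  have gi : increasing (g u).
    by move=> w s; rewrite addr0 /g !ffunE; case: eqP.
  have gu : influence (g u) u 1 by move=> s; rewrite /g !ffunE eqxx add0r.
  have [w hw] := run_influence beta_gt0 sadj (leqnn _) nbr ind ler01 gi gu.
  rewrite mulr1 size_rounds in hw.
  by apply: influence_extremes hw; apply: run_increasing.
have var s : mean (P ^+ t) (fun s' => f s' ^+ 2) s - mean (P ^+ t) f s ^+ 2 <= #|C|%:R / 4.
  have -> : (fun s' => f s' ^+ 2) = fun s' => \sum_(u in C) \sum_(v in C) g u s' * g v s'.
    by apply/funext => s'; rewrite expr2 big_distrlr.
  rewrite !mean_sum expr2 big_distrlr /= -sumrB mulr_natl -sumr_const.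
  apply: ler_sum => u uC.
  rewrite mean_sum -sumrB (bigD1 u)//= big1 ?addr0 => [|v /andP[vC vu]].
    have -> : (fun s' => g u s' * g u s') = g u.
      by apply/funext => s'; rewrite /g; case: (s' u); rewrite ?mulr1 ?mulr0.
    (* [x - x ^+ 2 <= 1 / 4], the variance of an indicator. *)
    by set x := mean _ _ _; have := sqr_ge0 (x - 2^-1); lra.
  rewrite !mean_rounds (@runM _ _ _ _ _ [set u] [set v] _ _ ind) ?subrr//.
  - exact: plus_depends.
  - exact: plus_depends.
  - by rewrite size_rounds; apply: disC => //; rewrite eq_sym.
have tv x : tv_dist (trans (P ^+ t) x) mu <= 4^-1.
  by apply: le_trans mixed; apply: le_bigmax.
have P0 x y : 0 <= trans (P ^+ t) x y.
  by rewrite trans_mean mean_rounds; apply: run_ge0 => s; case: eqP.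
have P1 : mean (P ^+ t) (fun=> 1) = fun=> 1 by rewrite mean_rounds run1.
have := mean_gap P0 P1 (tv [ffun=> true]) (tv [ffun=> false]) (var _) (var _).
set m := #|C|%:R in gap var *; have m0 : 0 <= m by exact: ler0n.
move=> gap2.
have sq : m * (m * d ^+ (8 * t)) <= m * 2.
  have -> : m * (m * d ^+ (8 * t)) = (m * d ^+ (4 * t)) ^+ 2.
    by rewrite [RHS]exprMn -exprM mulnAC mulrA -expr2.
  apply: le_trans (le_trans gap2 _); last by lra.
  by rewrite lerXn2r// ?nnegrE ?(le_trans _ gap) ?mulr_ge0 ?exprn_ge0 ?(ltW d0).
have md : m * d ^+ (8 * t) <= 2.
  have [m1|] := ltrP 0 m; first by rewrite ler_pM2l in sq.
  by move=> m1; have -> : m = 0 by [apply/le_anti/andP]; rewrite mul0r.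
have n1 : #|V|%:R <= m * D.+1%:R ^+ (8 * t).
  by rewrite /m -natrX -natrM ler_nat (leq_trans cardC)// -mulnDl.
apply: (@le_trans _ _ (m * D.+1%:R ^+ (8 * t) * d ^+ (8 * t))).
  by rewrite ler_wpM2r// exprn_ge0// ltW.
by rewrite mulrAC ler_wpM2r// exprn_ge0.
Qed.

End EvenOdd.

(** An isolated vertex would let no influence survive its resampling. *)
Lemma connected_nbr (V : finType) (adj : rel V) (v : V) :
  connected_graph adj -> (1 < #|V|)%N -> exists x, adj v x.
Proof.
move=> conn /card_gt1P[x [y [_ _ xy]]].
have [z vz] : exists z, v != z.
  by have [->|] := eqVneq v x; [exists y|exists x].
have /connectP[[|w p]] := conn v z; first by move=> _ /= zv; rewrite zv eqxx in vz.
by move=> /= /andP[vw _] _; exists w.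
Qed.

Theorem lemma4p1 (R : realType) (Delta : nat) (beta : R) (beta_gt0 : 0 < beta) :
  exists2 c : R, 0 < c &
  exists n0 : nat, forall (n : nat) (V : finType) (adj : rel V) (VE VO : {set V}),
    (n0 <= n)%N -> #|V| = n ->
    simple_graph adj -> connected_graph adj -> bipartition adj VE VO ->
    max_degree adj = Delta ->
    ((c * ln n%:R)%:E <= mixing_time (gibbs adj beta) (P_EOE adj beta VE VO))%E.
Proof.
have d0 := flip_gap_gt0 beta_gt0 Delta; have d1 := flip_gap_le1 beta_gt0 Delta.
set d := flip_gap beta Delta in d0 d1.
(* One step costs a factor [K ^+ 8]: the packing loses [Delta.+1 ^+ 8] and the
   squared difference of means loses [d ^+ 8]. *)
pose K : R := Delta.+1%:R / d.
have K1 : 1 <= K by rewrite ler_pdivlMr// mul1r (le_trans d1)// ler1n.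
have K0 : 0 < K by apply: lt_le_trans K1.
have lnK : 0 <= ln K by exact: ln_ge0.
have ln2 : 0 < ln (2 : R) by rewrite ln_gt0// ltr1n.
have a0 : 0 < ln 2 + 8 * ln K by rewrite ltr_pwDl// mulr_ge0.
exists (ln 2 + 8 * ln K)^-1; first by rewrite invr_gt0.
exists 2 => n V adj VE VO n2 Vn sadj conn bip degD.
apply/ereal_infP => _ [t [t0 mixed] <-]; rewrite lee_fin mulrC ler_pdivrMr//.
have nbr v : exists x, adj v x by apply: connected_nbr => //; rewrite Vn.
have := mixed_card sadj bip beta_gt0 nbr mixed; rewrite degD Vn -/d => le.
have n0 : (0 < n%:R :> R) by rewrite ltr0n (leq_trans _ n2).
have nK : n%:R <= 2 * K ^+ (8 * t).
  by rewrite expr_div_n mulrA ler_pdivlMr ?exprn_gt0.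
apply: (@le_trans _ _ (ln (2 * K ^+ (8 * t)))).
  by rewrite ler_ln// posrE mulr_gt0// exprn_gt0.
rewrite lnM ?posrE ?exprn_gt0// lnXn// -[ln K *+ _]mulr_natl natrM.
have t1 : 1 <= t%:R :> R by rewrite ler1n.
have := mulr_ge0 (ltW ln2) (_ : 0 <= t%:R - 1 :> R); rewrite subr_ge0 => /(_ t1).
lra.
Qed.
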